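(* Let $f=\frac1n\sum_{i=1}^n f_i$, where each $f_i:\mathbb{R}^d\to\mathbb{R}$ is differentiable, bounded below by $f_i^{\inf}\in\mathbb{R}$, and ${\bf L}_i$-matrix smooth with ${\bf L}_i\in\mathbb{S}^d_{++}$. Assume $f(x)\ge f^{\inf}$ for all $x$ (some $f^{\inf}\in\mathbb{R}$) and that $f$ is ${\bf L}$-matrix smooth with ${\bf L}\in\mathbb{S}^d_+$. Let $\{{\bf S}_i^k: i\in[n],k\ge0\}$ be mutually independent random matrices, each with a common distribution $\mathcal S$ on $\mathbb{S}^d_+$ satisfying $\mathbb{E}[{\bf S}_i^k]={\bf I}_d$. Let ${\bf D}\in\mathbb{S}^d_{++}$ satisfy ${\bf D}{\bf L}{\bf D}\preceq{\bf D}$, fix $x^0$, and let $$x^{k+1}=x^k-\frac{{\bf D}}{n}\sum_{i=1}^n{\bf S}_i^k\nabla f_i(x^k).$$ Then for every $K\ge1$, $$\min_{0\le k\le K-1}\mathbb{E}\Big[\|\nabla f(x^k)\|^2_{{\bf D}/\det({\bf D})^{1/d}}\Big]\le\frac{2(1+\frac{\lambda_{{\bf D}}}{n})^K(f(x^0)-f^{\inf})}{\det({\bf D})^{1/d}K}+\frac{2\lambda_{{\bf D}}\Delta^{\inf}}{\det({\bf D})^{1/d}n},$$ where $\Delta^{\inf}:=f^{\inf}-\frac1n\sum_{i=1}^nf_i^{\inf}$ and $\lambda_{{\bf D}}:=\max_i\lambda_{\max}\big(\mathbb{E}[{\bf L}_i^{1/2}({\bf S}_i^k-{\bf I}_d){\bf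 D}{\bf L}{\bf D}({\bf S}_i^k-{\bf I}_d){\bf L}_i^{1/2}]\big)$.
   Context: A differentiable $g:\mathbb{R}^d\to\mathbb{R}$ is ${\bf M}$-matrix smooth if $g(x)\le g(y)+\langle\nabla g(y),x-y\rangle+\frac12\langle{\bf M}(x-y),x-y\rangle$ for all $x,y$. $\mathbb{S}^d_{+}$/$\mathbb{S}^d_{++}$: symmetric positive semidefinite/definite $d\times d$ matrices; $\preceq$ is the Loewner order; $\|x\|_{{\bf Q}}^2:=\langle{\bf Q}x,x\rangle$. All expectations are assumed finite. *)

(* Defs.v *)
From HB Require Import structures.
From mathcomp Require Import all_boot all_order all_algebra.
From mathcomp Require Import all_classical all_reals all_analysis.
Set Implicit Arguments. Unset Strict Implicit. Unset Printing Implicit Defensive.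
Import Order.TTheory GRing.Theory Num.Theory.
Import numFieldNormedType.Exports.
Local Open Scope classical_set_scope.
Local Open Scope ring_scope.

Section defs.
Variable R : realType.
Variable d : nat.

Definition dotv (u v : 'cV[R]_d) : R := (u^T *m v) 0 0.

Definition qnorm2 (Q : 'M[R]_d) (x : 'cV[R]_d) : R := dotv (Q *m x) x.

Definition psd (A : 'M[R]_d) : Prop :=
  A^T = A /\ forall v : 'cV[R]_d, 0 <= qnorm2 A v.
Definition pd (A : 'M[R]_d) : Prop :=
  A^T = A /\ forall v : 'cV[R]_d, v != 0 -> 0 < qnorm2 A v.

Definition loewner_le (A B : 'M[R]_d) : Prop := psd (B - A).

Definition grad (g : 'cV[R]_d -> R) (x : 'cV[R]_d) : 'cV[R]_d :=
  \col_(j < d) derive g x (delta_mx j 0).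

Definition matrix_smooth (g : 'cV[R]_d -> R) (M : 'M[R]_d) : Prop :=
  forall x y : 'cV[R]_d,
    g x <= g y + dotv (grad g y) (x - y) + 2^-1 * qnorm2 M (x - y).

Definition lambda_max (A : 'M[R]_d) : R := sup [set a : R | eigenvalue A a].

End defs.

Section prob.
Context {dT : measure_display} {T : measurableType dT} {R : realType}.
Variable P : probability T R.
Variable d : nat.

Definition mexp (M : T -> 'M[R]_d) : 'M[R]_d :=
  \matrix_(a, b) fine ('E_P[fun w => M w a b]).

Definition mx_integrable (M : T -> 'M[R]_d) : Prop :=
  forall a b, P.-integrable setT (EFin \o (fun w => M w a b)).

Definition mx_measurable (M : T -> 'M[R]_d) : Prop :=
  forall a b, measurable_fun setT (fun w => M w a b).

Definition mx_event (M : T -> 'M[R]_d) (B : 'I_d -> 'I_d -> set R) : set T :=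
  [set w | forall a b, B a b (M w a b)].

(* mutual independence of a family of random matrices indexed by I:
   product rule for every finite subfamily (indices in a duplicate-free list)
   and every choice of measurable rectangles (rectangles form a pi-system
   generating the Borel sigma-algebra of R^(d x d)) *)
Definition mutually_independent_mx (I : eqType) (S : I -> T -> 'M[R]_d) : Prop :=
  forall (J : seq I) (B : I -> 'I_d -> 'I_d -> set R),
    uniq J -> (forall j a b, measurable (B j a b)) ->
    P (\big[setI/setT]_(j <- J) mx_event (S j) (B j)) =
    (\prod_(j <- J) P (mx_event (S j) (B j)))%E.

(* two random matrices have the same distribution (laws agree on the
   generating pi-system of measurable rectangles) *)
Definition same_distribution_mx (M N : T -> 'M[R]_d) : Prop :=
  forall B : 'I_d -> 'I_d -> set R, (forall a b, measurable (B a b)) ->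
    P (mx_event M B) = P (mx_event N B).

End prob.

Fixpoint iterate {T : Type} {R : realType} {d n : nat}
  (fs : 'I_n -> 'cV[R]_d -> R) (D : 'M[R]_d) (S : 'I_n -> nat -> T -> 'M[R]_d)
  (x0 : 'cV[R]_d) (k : nat) (w : T) : 'cV[R]_d :=
  match k with
  | 0 => x0
  | k'.+1 =>
      let xk := iterate fs D S x0 k' w in
      xk - (n%:R^-1 : R) *: (D *m \sum_(i < n) (S i k' w *m grad (fs i) xk))
  end.

(* Main.v *)
(** For a fixed point x, matrix smoothness of f bounds f at the next iterate by
    a quadratic function of the sketches.  Taking expectations, the linear terms
    vanish because the sketches have mean I, the cross terms of the quadratic
    term vanish by independence, and each diagonal term is at most lambda_D times
    the squared norm of grad f_i in the metric of L_i^-1, hence at most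
    2 lambda_D (f_i(x) - f_i^inf).  With D L D <= D this gives
      E[f(x+) - f^inf] + |grad f(x)|_D^2 / 2
        <= (1 + lambda_D / n) (f(x) - f^inf) + lambda_D Delta^inf / n.
    The iterate x^k is measurable with respect to the sketches of the previous
    rounds, so the law of (x^k, S^k) is a product and Tonelli's theorem transfers
    this bound to the random iterates.  Unrolling the resulting recursion bounds
    the minimum. *)

Require Import Defs.
From HB Require Import structures.
From mathcomp Require Import all_boot all_order all_algebra.
From mathcomp Require Import all_classical all_reals all_analysis.
From mathcomp Require Import measurable_realfun ring lra.
Import Order.TTheory GRing.Theory Num.Theory.
Import numFieldNormedType.Exports.
Local Open Scope classical_set_scope.
Local Open Scope ring_scope.

(** * Quadratic forms, Rayleigh quotients and gradient bounds from matrix smoothness *)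

Section quadratic_forms.
Context {R : realType} {d : nat}.
Implicit Types (u v w : 'cV[R]_d) (A B : 'M[R]_d) (a : R).

Lemma dotvE u v : dotv u v = \sum_i u i 0 * v i 0.
Proof. by rewrite /dotv mxE; apply: eq_bigr => i _; rewrite mxE. Qed.

Lemma dotvC u v : dotv u v = dotv v u.
Proof. by rewrite !dotvE; apply: eq_bigr => i _; rewrite mulrC. Qed.

Lemma dotvDl u v w : dotv (u + v) w = dotv u w + dotv v w.
Proof. by rewrite /dotv linearD mulmxDl mxE. Qed.

Lemma dotvDr u v w : dotv w (u + v) = dotv w u + dotv w v.
Proof. by rewrite /dotv mulmxDr mxE. Qed.

Lemma dotvZl a u v : dotv (a *: u) v = a * dotv u v.
Proof. by rewrite /dotv linearZ -scalemxAl mxE. Qed.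

Lemma dotvZr a u v : dotv u (a *: v) = a * dotv u v.
Proof. by rewrite dotvC dotvZl dotvC. Qed.

Lemma dotvNl u v : dotv (- u) v = - dotv u v.
Proof. by rewrite -scaleN1r dotvZl mulN1r. Qed.

Lemma dotvNr u v : dotv u (- v) = - dotv u v.
Proof. by rewrite dotvC dotvNl dotvC. Qed.

Lemma dotv0l u : dotv 0 u = 0.
Proof. by rewrite -(scale0r 0) dotvZl mul0r. Qed.

Lemma dotv_suml (I : Type) (r : seq I) (F : I -> 'cV[R]_d) v :
  dotv (\sum_(i <- r) F i) v = \sum_(i <- r) dotv (F i) v.
Proof.
elim: r => [|i r IH]; first by rewrite !big_nil dotv0l.
by rewrite !big_cons dotvDl IH.
Qed.

Lemma dotv_sumr (I : Type) (r : seq I) (F : I -> 'cV[R]_d) v :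
  dotv v (\sum_(i <- r) F i) = \sum_(i <- r) dotv v (F i).
Proof.
by rewrite dotvC dotv_suml; apply: eq_bigr => i _; rewrite dotvC.
Qed.

Lemma dotv_mulmxl A u v : dotv (A *m u) v = dotv u (A^T *m v).
Proof. by rewrite /dotv trmx_mul mulmxA. Qed.

Lemma dotvv_ge0 v : 0 <= dotv v v.
Proof. by rewrite dotvE sumr_ge0 // => i _; rewrite -expr2 sqr_ge0. Qed.

Lemma dotvv_gt0 v : v != 0 -> 0 < dotv v v.
Proof.
move=> vn0; rewrite lt_def dotvv_ge0 andbT; apply: contraNN vn0 => /eqP vv0.
apply/eqP/matrixP => i j; rewrite ord1 mxE; apply/eqP.
move: vv0; rewrite dotvE => /eqP.
rewrite psumr_eq0 => [|k _]; last by rewrite -expr2 sqr_ge0.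
by move=> /allP/(_ i (mem_index_enum _))/=; rewrite mulf_eq0 orbb.
Qed.

Lemma qnorm2Z A a v : qnorm2 A (a *: v) = a ^+ 2 * qnorm2 A v.
Proof. by rewrite /qnorm2 -scalemxAr dotvZl dotvZr; ring. Qed.

Lemma qnorm2D A u v : A^T = A ->
  qnorm2 A (u + v) = qnorm2 A u + 2 * dotv (A *m u) v + qnorm2 A v.
Proof.
move=> As; rewrite /qnorm2 mulmxDr !dotvDl !dotvDr.
by rewrite (dotv_mulmxl A v u) As (dotvC v); ring.
Qed.

Lemma qnorm2_sum_entries A v :
  qnorm2 A v = \sum_i \sum_j A i j * (v j 0 * v i 0).
Proof.
rewrite /qnorm2 dotvE; apply: eq_bigr => i _.
by rewrite mxE mulr_suml; apply: eq_bigr => j _; rewrite mulrA.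
Qed.

(** The form is nonnegative at every [u + t *: v], and this quadratic polynomial in [t] is evaluated
    at a suitable point. If [qnorm2 A v] is 0 the polynomial is affine, which forces its slope to
    vanish. *)
Lemma psd_cauchy_schwarz A u v : psd A ->
  dotv (A *m u) v ^+ 2 <= qnorm2 A u * qnorm2 A v.
Proof.
case=> As A0; set b := dotv _ _.
have q t : 0 <= qnorm2 A u + 2 * t * b + t ^+ 2 * qnorm2 A v.
  by have := A0 (u + t *: v); rewrite qnorm2D// dotvZr qnorm2Z -/b mulrA.
have := A0 v; have := A0 u; move: q.
set x := qnorm2 A u; set y := qnorm2 A v => q x0.
rewrite le_eqVlt => /predU1P[y0|y0].
  have [-> |bn0] := eqVneq b 0; first by rewrite -y0 mulr0 expr0n.
  have := q (- (x + 1) / (2 * b)); rewrite -y0 mulr0 addr0.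
  have -> : x + 2 * (- (x + 1) / (2 * b)) * b = -1 by field; rewrite bn0.
  by rewrite oppr_ge0 ler10.
(* The minimiser of the polynomial. *)
have := q (- b / y).
have -> : x + 2 * (- b / y) * b + (- b / y) ^+ 2 * y = (x * y - b ^+ 2) / y.
  by field; rewrite gt_eqF.
by rewrite pmulr_lge0 ?invr_gt0// subr_ge0.
Qed.

Lemma pd_unitmx A : pd A -> A \in unitmx.
Proof.
case=> As A0; rewrite unitmxE unitfE; apply/det0P => -[v vn0 vA].
have := A0 v^T; rewrite /qnorm2 -As -trmx_mul vA trmx0 dotv0l ltxx.
by rewrite -(inj_eq trmx_inj) trmxK trmx0 => /(_ vn0).
Qed.

(** Each product of two coordinates is at most the squared norm in absolute value. The constant is
    crude; its use is to make suprema over the unit sphere finite. *)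
Lemma qnorm2_le_dotv A v :
  qnorm2 A v <= (\sum_i \sum_j `|A i j|) * dotv v v.
Proof.
have sq i : v i 0 ^+ 2 <= dotv v v.
  rewrite dotvE (bigD1 i)//= -expr2 lerDl sumr_ge0// => j _.
  by rewrite -expr2 sqr_ge0.
rewrite qnorm2_sum_entries mulr_suml; apply: ler_sum => i _.
rewrite mulr_suml; apply: ler_sum => j _.
apply: (le_trans (ler_norm _)); rewrite normrM ler_wpM2l//.
rewrite ler_norml; have := sq i; have := sq j.
have := sqr_ge0 (v i 0 + v j 0); have := sqr_ge0 (v i 0 - v j 0).
by move=> *; apply/andP; split; nra.
Qed.

(* With [t] the supremum of the Rayleigh quotient, [t - A] is psd; were it
   invertible, Cauchy-Schwarz would bound it away from 0 on the unit sphere,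
   contradicting the choice of [t].  So [t] is an eigenvalue. *)
Lemma rayleigh_le_lambda_max A u : A^T = A ->
  qnorm2 A u <= lambda_max A * dotv u u.
Proof.
move=> As.
have [-> |un0] := eqVneq u 0; first by rewrite /qnorm2 mulmx0 dotv0l mulr0.
pose E := [set qnorm2 A v | v in [set v : 'cV[R]_d | dotv v v = 1]].
have ubE : ubound E (\sum_i \sum_j `|A i j|).
  by move=> _ [v /= v1 <-]; rewrite (le_trans (qnorm2_le_dotv A v))// v1 mulr1.
have unit_scale v : v != 0 ->
    dotv ((Num.sqrt (dotv v v))^-1 *: v) ((Num.sqrt (dotv v v))^-1 *: v) = 1.
  move=> vn0; have vv := dotvv_gt0 v vn0.
  rewrite dotvZl dotvZr mulrA -expr2 exprVn sqr_sqrtr ?ltW//.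
  by rewrite mulVf// gt_eqF.
have E0 : E !=set0 by exists (qnorm2 A ((Num.sqrt (dotv u u))^-1 *: u)),
  ((Num.sqrt (dotv u u))^-1 *: u) => //=; exact: unit_scale.
have hE : has_sup E by split => //; exists (\sum_i \sum_j `|A i j|).
pose t := sup E.
have le_t v : qnorm2 A v <= t * dotv v v.
  have [-> |vn0] := eqVneq v 0; first by rewrite /qnorm2 mulmx0 dotv0l mulr0.
  have vv := dotvv_gt0 v vn0.
  have : qnorm2 A ((Num.sqrt (dotv v v))^-1 *: v) <= t.
    by apply: sup_ubound => //; [case: hE|exists ((Num.sqrt (dotv v v))^-1 *: v) => //=; exact: unit_scale].
  by rewrite qnorm2Z exprVn sqr_sqrtr ?(dotvv_ge0 v)// ler_pdivrMl// mulrC.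
pose B := t%:M - A.
have qB v : qnorm2 B v = t * dotv v v - qnorm2 A v.
  by rewrite /qnorm2 mulmxBl mul_scalar_mx dotvDl dotvZl dotvNl.
have psdB : psd B.
  split; first by rewrite linearB/= tr_scalar_mx As.
  by move=> v; rewrite qB subr_ge0.
have detB : \det B == 0.
  apply/negPn/negP => detB.
  have Bu : B \in unitmx by rewrite unitmxE unitfE.
  pose C := \sum_i \sum_j `|invmx B i j|.
  (* Cauchy-Schwarz for [B] at [invmx B *m v] and [v]: the left side is 1, and the form at the first
     vector is that of [invmx B] at [v], hence at most [C]. *)
  have C1 v : dotv v v = 1 -> 1 <= C * (t - qnorm2 A v).
    move=> v1; have := psd_cauchy_schwarz B (invmx B *m v) v psdB.
    have qi : qnorm2 B (invmx B *m v) <= C.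
      have := qnorm2_le_dotv (invmx B) v; rewrite v1 mulr1 /qnorm2.
      by rewrite mulKVmx// dotvC.
    rewrite mulKVmx// v1 expr1n (qB v) v1 mulr1 => /le_trans; apply.
    rewrite ler_wpM2r//.
    by have := le_t v; rewrite v1 mulr1 subr_ge0.
  have [_ [v0 /= v01 _]] := E0.
  have C0 : 0 < C.
    have := C1 v0 v01; have := le_t v0; rewrite v01 mulr1 => ? ?.
    have : 0 <= C by apply: sumr_ge0 => i _; apply: sumr_ge0.
    rewrite le_eqVlt => /predU1P[C00|//].
    by have := C1 v0 v01; rewrite -C00 mul0r ler10.
  (* By [C1] the number [t - C^-1] already bounds all Rayleigh quotients. *)
  have : t <= t - C^-1.
    apply: ge_sup => // _ [v /= v1 <-]; have := C1 v v1.
    rewrite mulrC -ler_pdivrMr// div1r; lra.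
  by move: C0; rewrite -invr_gt0; lra.
have ev : eigenvalue A t.
  move/det0P : detB => [v vn0 /eqP]; rewrite mulmxBr mul_mx_scalar subr_eq0.
  by move=> /eqP vA; apply/eigenvalueP; exists v.
apply: (le_trans (le_t u)); rewrite ler_wpM2r ?dotvv_ge0//.
(* The set of eigenvalues is bounded by [t]: by symmetry a transposed left eigenvector is an
   eigenvector, and its Rayleigh quotient is the eigenvalue. *)
apply: sup_ubound => //=; exists t => a /= /eigenvalueP[v vA vn0].
have wn0 : v^T != 0 by rewrite -(inj_eq trmx_inj) trmxK trmx0.
have Aw : A *m v^T = a *: v^T by rewrite -{1}As -trmx_mul vA linearZ.
have := le_t v^T; rewrite {1}/qnorm2 Aw dotvZl.
by rewrite ler_pM2r// dotvv_gt0.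
Qed.

(** At a nonzero base [powR] unfolds to an exponential. *)
Lemma powR_det_gt0 A (a : R) : A \in unitmx -> 0 < powR (\det A) a.
Proof.
by rewrite unitmxE unitfE /powR => /negbTE ->; exact: expR_gt0.
Qed.

(* The gradient step [h = Ls^-1 (grad g x)] in the smoothness inequality. *)
Lemma matrix_smooth_grad_bound (g : 'cV[R]_d -> R) Ls Lh m x :
  matrix_smooth g Ls -> (forall y, m <= g y) -> pd Ls ->
  psd Lh -> Lh *m Lh = Ls ->
  exists2 u, grad g x = Lh *m u & dotv u u <= 2 * (g x - m).
Proof.
move=> gL gm Lpd [Lhs _] LhLs.
have Lhu : Lh \in unitmx.
  move: (pd_unitmx _ Lpd); rewrite -LhLs !unitmxE det_mulmx unitrM.
  by case/andP.
(* For this witness [dotv u u] is the squared norm of the gradient in the metric of [invmx Ls]. *)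
exists (invmx Lh *m grad g x); first by rewrite mulKVmx.
set u := invmx Lh *m grad g x; have gE : grad g x = Lh *m u by rewrite mulKVmx.
pose h := invmx Lh *m u; have uE : u = Lh *m h by rewrite mulKVmx.
have := gL (x - h) x; have := gm (x - h).
have -> : x - h - x = - h by rewrite addrAC subrr add0r.
rewrite gE dotvNr dotv_mulmxl Lhs -uE -scaleN1r qnorm2Z.
rewrite /qnorm2 -LhLs -mulmxA -uE dotv_mulmxl Lhs -uE; lra.
Qed.

End quadratic_forms.

(** By contradiction: if every [r k] exceeds the bound, each round lowers [delta] by more than [e]
    after multiplication by [a]. As [a] is at least 1, the losses add up to at least [k%:R * e], and
    [e] is chosen so that [K] of them exhaust [a ^+ K * delta 0], making [delta K] negative. *)
Lemma descent_recursion (R : realType) (K : nat) (a b : R) (delta r : nat -> R) :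
  (0 < K)%N -> 1 <= a -> (forall k, 0 <= delta k) ->
  (forall k, delta k.+1 + 2^-1 * r k <= a * delta k + b) ->
  exists2 k, (k < K)%N & r k <= 2 * a ^+ K * delta 0%N / K%:R + 2 * b.
Proof.
move=> K0 a1 delta0 rec; apply/not_exists2P => H.
pose B := 2 * a ^+ K * delta 0%N / K%:R + 2 * b.
have rB k : (k < K)%N -> B < r k.
  by move=> kK; case: (H k) => // /negP; rewrite -ltNge.
have K0' : 0 < K%:R :> R by rewrite ltr0n.
pose e := 2^-1 * B - b.
have eE : K%:R * e = a ^+ K * delta 0%N.
  by rewrite /e /B; field; rewrite gt_eqF.
have e0 : 0 <= e.
  by rewrite -(pmulr_rge0 _ K0') eE mulr_ge0// exprn_ge0// (le_trans ler01).
(* The strict inequality fails at [k = 0], so the induction starts at 1. *)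
have dk k : (k <= K)%N -> (0 < k)%N -> delta k < a ^+ k * delta 0%N - k%:R * e.
  elim: k => // k IH kK _.
  have := rec k; have := rB k kK => rk reck.
  have step : delta k.+1 < a * delta k - e by rewrite /e; lra.
  apply: (lt_le_trans step); rewrite exprS -natr1 mulrDl mul1r.
  have [-> | k0] := posnP k; first by rewrite expr0 mul0r; lra.
  have := ltW (IH (ltnW kK) k0); set x := _ * delta 0%N => dle.
  have ke : 0 <= k%:R * e by rewrite mulr_ge0.
  rewrite -mulrA -/x; nra.
by have := dk K (leqnn _) K0; rewrite eE subrr ltNge delta0.
Qed.

(** * Measurability of continuous functions and gradients along random vectors *)

Section vector_measurability.
Context {R : realType} {d : nat} {dT : measure_display} {T : measurableType dT}.

Lemma cvg_mx_entries m n (u : nat -> 'M[R]_(m, n)) (M : 'M[R]_(m, n)) :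
  (forall i j, (u k i j) @[k --> \oo] --> M i j) -> u @ \oo --> M.
Proof.
move=> uM A [B MB BA]; suff : \forall k \near \oo, forall i j, B i j (u k i j).
  by apply: filterS => k Bk; exact: BA.
apply: filter_forall => i; apply: filter_forall => j.
exact: (uM i j (B i j) (MB i j)).
Qed.

(* Rounding [X] to the grid [Z^d / m.+1] gives countably valued functions
   converging to [X], for which measurability of [g \o X] is immediate. *)
Lemma measurable_continuous_comp_vec (g : 'cV[R]_d -> R) (X : T -> 'cV[R]_d) :
  continuous g -> (forall j, measurable_fun setT (fun w => X w j 0)) ->
  measurable_fun setT (fun w => g (X w)).
Proof.
move=> gc mX.
pose Z m w : 'cV[int]_d := \col_j Num.floor (m.+1%:R * X w j 0).
pose grid m (z : 'cV[int]_d) : 'cV[R]_d := \col_j (m.+1%:R^-1 * (z j 0)%:~R).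
apply: (@measurable_fun_cvg _ _ _ _
    (fun m w => g (grid m (Z m w)))) => [m|w _]; last first.
  apply: continuous_cvg; first exact: gc.
  apply: cvg_mx_entries => i j; rewrite (ord1 j).
  under eq_fun do rewrite !mxE.
  (* Rounding down lowers a coordinate by at most [harmonic k]. *)
  apply: (@squeeze_cvgr _ _ _ _ (fun k => X w i 0 - harmonic k) (fun k => X w i 0)).
  - near=> k; set x := X w i 0.
    have k0 : 0 < k.+1%:R :> R by [].
    have /andP[] := real_floor_itv (num_real (k.+1%:R * x)); rewrite intrD.
    set z := _ %:~R => zx xz.
    rewrite /harmonic/= ler_pdivrMl// zx andbT ler_pdivlMl// mulrBr.
    by rewrite mulfV ?gt_eqF//; lra.
  - rewrite -[X in _ --> X]subr0; apply: cvgB; first exact: cvg_cst.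
    exact: cvg_harmonic.
  - exact: cvg_cst.
move=> _ B mB; rewrite setTI.
(* The preimage is the countable union of the cells whose grid point is sent into [B]. *)
have -> : (fun w => g (grid m (Z m w))) @^-1` B =
    \bigcup_(z : 'cV[int]_d) (if asbool (B (g (grid m z))) then
       \bigcap_(j in [set: 'I_d])
         ((fun w => X w j 0) @^-1` [set x | Num.floor (m.+1%:R * x) == z j 0])
      else set0).
  apply/seteqP; split => [w /= Bw|w [z _] /=].
    exists (Z m w) => //; rewrite asboolT// => j _ /=.
    by rewrite mxE.
  case: ifPn => [/asboolP Bz|//] zw /=.
  suff -> : Z m w = z by [].
  by apply/matrixP => j k; rewrite (ord1 k) mxE; apply/eqP/zw.
apply: countable_bigcupT_measurable => [|z]; first exact: countableP.
case: ifPn => // _; apply: fin_bigcap_measurable => // j _.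
rewrite -[X in measurable X]setTI; apply: mX => //.
have -> : [set x : R | Num.floor (m.+1%:R * x) == z j 0] =
   [set` `[m.+1%:R^-1 * (z j 0)%:~R, m.+1%:R^-1 * (z j 0 + 1)%:~R[ ].
  apply/seteqP; split => x /=; rewrite in_itv/= ler_pdivrMl// ltr_pdivlMl//.
    by move=> /eqP <-; exact: real_floor_itv (num_real _).
  by move=> h; apply/eqP; apply: floor_def.
exact: measurable_itv.
Unshelve. all: by end_near. Qed.

(** A partial derivative is the pointwise limit of difference quotients with steps [harmonic m],
    each continuous in the point. *)
Lemma measurable_grad_comp (g : 'cV[R]_d -> R) (X : T -> 'cV[R]_d) i :
  (forall x, differentiable g x) ->
  (forall j, measurable_fun setT (fun w => X w j 0)) ->
  measurable_fun setT (fun w => grad g (X w) i 0).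
Proof.
move=> dg mX.
have gc : continuous g by move=> x; exact: differentiable_continuous.
pose e : 'cV[R]_d := delta_mx i 0.
apply: (@measurable_fun_cvg _ _ _ _
  (fun m w => (harmonic m)^-1 * (g (harmonic m *: e + X w) - g (X w))))
  => [m|w _].
  apply: measurable_funM => //; apply: measurable_funB; last first.
    exact: measurable_continuous_comp_vec.
  apply: measurable_continuous_comp_vec => // j.
  under eq_fun do rewrite !mxE.
  by apply: measurable_funD => //; exact: mX.
rewrite mxE -/e.
have /cvgr_dnbhsP := diff_derivable (v := e) (dg (X w)).
apply; split; first by move=> n; rewrite gt_eqF// harmonic_gt0.
exact: cvg_harmonic.
Qed.

End vector_measurability.

(** * Random variables with a finite mean *)

Section means.
Context {dT : measure_display} {T : measurableType dT} {R : realType}.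
Variable P : probability T R.
Implicit Types (X Y : T -> R).

(** Integrability travels with the value, so linear combinations of means carry their own
    integrability proofs. *)
Definition has_mean X (m : R) :=
  P.-integrable setT (EFin \o X) /\ (\int[P]_w (X w)%:E = m%:E)%E.

Lemma has_mean_ext X Y m : X =1 Y -> has_mean X m -> has_mean Y m.
Proof. by move=> /funext ->. Qed.

Lemma has_mean_integrable X : P.-integrable setT (EFin \o X) ->
  has_mean X (fine 'E_P[X]).
Proof. by move=> iX; split=> //; rewrite unlock fineK// integrable_fin_num. Qed.

Lemma has_mean_cst r : has_mean (fun=> r) r.
Proof.
split; first exact: finite_measure_integrable_cst.
by rewrite integral_cst//= probability_setT mule1.
Qed.

Lemma has_meanD X Y m m' : has_mean X m -> has_mean Y m' ->
  has_mean (fun w => X w + Y w) (m + m').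
Proof.
move=> [iX EX] [iY EY]; split; first exact: (integrableD measurableT iX iY).
under eq_integral do rewrite EFinD.
by rewrite (integralD measurableT iX iY) EX EY.
Qed.

Lemma has_meanZ r X m : has_mean X m -> has_mean (fun w => r * X w) (r * m).
Proof.
move=> [iX EX]; split; first exact: (integrableZl measurableT r iX).
under eq_integral do rewrite EFinM.
by rewrite (integralZl measurableT iX) EX.
Qed.

Lemma has_mean_sum (I : Type) (r : seq I) (X : I -> T -> R) (m : I -> R) :
  (forall i, has_mean (X i) (m i)) ->
  has_mean (fun w => \sum_(i <- r) X i w) (\sum_(i <- r) m i).
Proof.
move=> Xm; elim: r => [|i r IH].
  by rewrite big_nil; apply: has_mean_ext (has_mean_cst 0) => w; rewrite big_nil.
rewrite big_cons; apply: has_mean_ext (has_meanD _ _ _ _ (Xm i) IH) => w.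
by rewrite big_cons.
Qed.

Lemma has_mean_unique X m m' : has_mean X m -> has_mean X m' -> m = m'.
Proof. by move=> [_ E] [_]; rewrite E => -[]. Qed.

End means.

(** * Independent random elements: product law, Tonelli and Fubini *)

Section decoupling.
Context {dT d0 d1 : measure_display} {T : measurableType dT}
  {U0 : measurableType d0} {U1 : measurableType d1} {R : realType}.
Variable P : probability T R.
Variables (X : {mfun T >-> U0}) (Y : {mfun T >-> U1}).
Hypothesis XY : forall A B, measurable A -> measurable B ->
  P ((X @^-1` A) `&` (Y @^-1` B)) = (P (X @^-1` A) * P (Y @^-1` B))%E.

Let pair w := (X w, Y w).
Let mpair : measurable_fun setT pair.
Proof. exact: measurable_fun_pair. Qed.
HB.instance Definition _ := isMeasurableFun.Build _ _ _ _ pair mpair.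

Let joint_law A : measurable A ->
  (distribution P X \x distribution P Y)%E A = distribution P pair A.
Proof.
by move=> mA; apply: product_measure_unique => // B C mB mC; exact: XY.
Qed.

(** Independence makes the law of the pair the product of the laws; Tonelli's theorem then splits
    the integral. *)
Lemma ge0_decoupling (phi : U0 * U1 -> \bar R) :
  measurable_fun setT phi -> (forall z, 0 <= phi z)%E ->
  (\int[P]_w phi (X w, Y w) = \int[P]_w \int[P]_w' phi (X w, Y w'))%E.
Proof.
move=> mphi phi0.
transitivity (\int[distribution P pair]_z phi z)%E.
  by rewrite ge0_integral_distribution.
rewrite (eq_measure_integral (distribution P X \x distribution P Y)%E)/=; last first.
  by move=> A mA _; rewrite joint_law.
rewrite fubini_tonelli1// ge0_integral_distribution//.
- apply: eq_integral => w _; rewrite /fubini_F /= ge0_integral_distribution//.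
  exact: measurable_fun_pair2.
- exact: measurable_fun_fubini_tonelli_F.
- by move=> x; apply: integral_ge0.
Qed.

Lemma has_mean_indepM (y : U0 -> R) (z : U1 -> R) (my mz : R) :
  measurable_fun setT y -> measurable_fun setT z ->
  has_mean P (y \o X) my -> has_mean P (z \o Y) mz ->
  has_mean P (fun w => y (X w) * z (Y w)) (my * mz).
Proof.
move=> mfy mfz [iy Ey] [iz Ez].
pose phi (p : U0 * U1) : \bar R := (y p.1 * z p.2)%:E.
have mphi : measurable_fun setT phi.
  by apply/measurable_EFinP; apply: measurable_funM;
    [exact: (measurableT_comp mfy)|exact: (measurableT_comp mfz)].
(* Decoupling [|phi|] gives the product of the two absolute moments, both finite; Fubini's theorem
   then applies to [phi] itself. *)
have iphi : P.-integrable setT (phi \o pair).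
  apply/integrableP; split; first exact: measurableT_comp.
  rewrite (ge0_decoupling (fun p => `|phi p|)%E)//; last first.
    exact: measurableT_comp.
  have [_ iz'] := integrableP _ _ _ iz.
  have [_ iy'] := integrableP _ _ _ iy.
  under eq_integral => w _.
    under eq_integral => w' _ do rewrite /phi/= normrM EFinM.
    rewrite ge0_integralZl//; last first.
      apply/measurable_EFinP; apply: measurableT_comp => //.
      exact: measurableT_comp.
    over.
  rewrite ge0_integralZr//; last 2 first.
  - apply/measurable_EFinP; apply: measurableT_comp => //.
    exact: measurableT_comp.
  - exact: integral_ge0.
  apply: lte_mul_pinfty => //; first exact: integral_ge0.
  by rewrite ge0_fin_numE//; exact: integral_ge0.
split=> //.
transitivity (\int[distribution P pair]_z phi z)%E.
  by rewrite integral_distribution.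
have iphi' : (distribution P X \x distribution P Y)%E.-integrable setT phi.
  apply/integrableP; split => //.
  rewrite (eq_measure_integral (distribution P pair))/=; last first.
    by move=> A mA _; exact: joint_law.
  rewrite ge0_integral_distribution//.
    by have /integrableP[] := iphi.
  apply/measurable_EFinP; apply: measurableT_comp => //.
  exact/measurable_EFinP.
rewrite (eq_measure_integral (distribution P X \x distribution P Y)%E)/=; last first.
  by move=> A mA _; rewrite joint_law.
rewrite -integral12_prod_meas1//.
have FE w : fubini_F (distribution P Y) phi w = (mz%:E * (y w)%:E)%E.
  rewrite /fubini_F integral_distribution/=; last 2 first.
  - exact: measurable_fun_pair2.
  - exact: (integrableZl measurableT (y w) iz).
  under eq_integral do rewrite /phi/= EFinM.
  by rewrite integralZl// Ez muleC.
under eq_integral do rewrite FE.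
rewrite integral_distribution; last 2 first.
- by apply: measurable_funeM; apply/measurable_EFinP.
- exact: (integrableZl measurableT mz iy).
by rewrite /= integralZl// Ey -EFinM mulrC.
Qed.

End decoupling.

(** * Extension of independence from a pi-system *)

Section independence_extension.
Context {dT : measure_display} {T : measurableType dT} {R : realType}.
Variable P : probability T R.

(** The sets obeying the product rule with [E] form a Dynkin system. *)
Lemma indep_sigma_algebra (G : set (set T)) (E : set T) :
  setI_closed G -> G `<=` measurable -> measurable E ->
  (forall A, G A -> P (E `&` A) = (P E * P A)%E) ->
  forall A, <<s G >> A -> P (E `&` A) = (P E * P A)%E.
Proof.
move=> GI Gm mE EG.
have sGm : <<s G >> `<=` measurable.
  by apply: smallest_sub => //; exact: sigma_algebra_measurable.
apply: (@dynkin_induction _ (g_sigma_algebraType G) G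
  [set A | P (E `&` A) = (P E * P A)%E]) => //=.
- by rewrite setIT probability_setT mule1.
- move=> A /sGm mA EA; rewrite -setDE probability_setC//.
  rewrite measureD//; last by rewrite ltey_eq fin_num_measure.
  rewrite /= EA -(fineK (fin_num_measure P _ mE)) -(fineK (fin_num_measure P _ mA)).
  by rewrite -EFinM -!EFinB -EFinM mulrBr mulr1.
- move=> F mF tF EF; have mF' k : (measurable : set (set T)) (F k) by exact: (sGm _ (mF k)).
  rewrite setI_bigcupr (measure_bigcup P setT F)// measure_bigcup//=; last 2 first.
  - by move=> k _; exact: measurableI.
  - exact: trivIset_setIl.
  rewrite -(fineK (fin_num_measure P _ mE)) -nneseriesZl//.
  by apply: eq_eseriesr => k _; rewrite EF fineK// fin_num_measure.
Qed.

End independence_extension.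

(** * Sigma-algebras generated by groups of independent random matrices *)

Section random_matrices.
Context {dT : measure_display} {T : measurableType dT} {R : realType} {d : nat}.
Variable P : probability T R.
Context {I : eqType}.
Variable S : I -> T -> 'M[R]_d.
Hypothesis mS : forall j, mx_measurable (S j).

Lemma mx_eventI (M : T -> 'M[R]_d) B B' :
  mx_event M B `&` mx_event M B' = mx_event M (fun a b => B a b `&` B' a b).
Proof.
apply/seteqP; split => [w [h h'] a b|w h]; first by split; [exact: h|exact: h'].
by split => a b; have [] := h a b.
Qed.

Lemma measurable_mx_event (M : T -> 'M[R]_d) B : mx_measurable M ->
  (forall a b, measurable (B a b)) -> measurable (mx_event M B).
Proof.
move=> mM mB.
have -> : mx_event M B = \bigcap_(a in [set: 'I_d]) \bigcap_(b in [set: 'I_d])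
    ((fun w => M w a b) @^-1` B a b).
  by apply/seteqP; split => [w h a _ b _|w h a b]; [exact: h|exact: (h a _ b)].
apply: fin_bigcap_measurable => // a _; apply: fin_bigcap_measurable => // b _.
by rewrite -[X in measurable X]setTI; exact: mM.
Qed.

Definition mx_cylinder (J : seq I) (B : I -> 'I_d -> 'I_d -> set R) : set T :=
  \big[setI/setT]_(j <- J) mx_event (S j) (B j).

Lemma mx_cylinderE J B :
  mx_cylinder J B = [set w | {in J, forall j, mx_event (S j) (B j) w}].
Proof.
rewrite /mx_cylinder; elim: J => [|j J IH].
  by rewrite big_nil; apply/seteqP; split.
rewrite big_cons IH; apply/seteqP; split => [w [Bj BJ] k|w BJ].
  by rewrite inE => /predU1P[-> //|]; exact: BJ.
by split=> [|k kJ]; apply: BJ; rewrite inE ?eqxx// kJ orbT.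
Qed.

Definition mx_cylinders (J : seq I) : set (set T) :=
  [set mx_cylinder J B | B in [set B | forall j a b, measurable (B j a b)]].

Lemma mx_cylinders_setI J : setI_closed (mx_cylinders J).
Proof.
move=> _ _ [B /= mB <-] [B' /= mB' <-].
exists (fun j a b => B j a b `&` B' j a b).
  by move=> j a b; exact: measurableI.
rewrite /mx_cylinder -big_split; apply: eq_bigr => j _.
by rewrite /= mx_eventI.
Qed.

Lemma measurable_mx_cylinders J : mx_cylinders J `<=` measurable.
Proof.
move=> _ [B /= mB <-]; rewrite /mx_cylinder; elim: J => [|j J IH].
  by rewrite big_nil.
by rewrite big_cons; apply: measurableI => //; exact: measurable_mx_event.
Qed.

(** The sample space [T] with the coarser sigma-algebra generated by the matrices indexed by [J]; a
    measurable function on it depends on those matrices only. *)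
Definition sigma_of (J : seq I) := g_sigma_algebraType (mx_cylinders J).
HB.instance Definition _ J := Measurable.copy (sigma_of J)
  (g_sigma_algebraType (mx_cylinders J)).

(** The identity as a random element, so that independence of sigma-algebras becomes independence of
    two random elements. *)
Definition to_sigma_of (J : seq I) (w : T) : sigma_of J := w.

Lemma sub_sigma_of J (A : set T) :
  (measurable : set (set (sigma_of J))) A -> measurable A.
Proof.
by move: A; apply: smallest_sub;
  [exact: sigma_algebra_measurable|exact: measurable_mx_cylinders].
Qed.

Lemma measurable_to_sigma_of J : measurable_fun setT (to_sigma_of J).
Proof. by move=> _ A mA; rewrite setTI; exact: (@sub_sigma_of J). Qed.

HB.instance Definition _ J := isMeasurableFun.Build _ _ _ _ (to_sigma_of J)
  (measurable_to_sigma_of J).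

Lemma measurable_mx_entry J j a b : j \in J ->
  measurable_fun setT (fun w : sigma_of J => S j w a b).
Proof.
move=> jJ _ B mB; rewrite setTI; apply: sub_gen_smallest.
(* The cylinder that constrains a single entry of a single matrix. *)
exists (fun j' a' b' => if [&& j' == j, a' == a & b' == b] then B else setT).
  by move=> j' a' b' /=; case: ifPn.
rewrite mx_cylinderE; apply/seteqP; split => w.
  by move=> /(_ j jJ a b); rewrite !eqxx.
move=> Bw j' _ a' b'; case: ifPn => // /and3P[/eqP -> /eqP -> /eqP ->].
exact: Bw.
Qed.

Hypothesis indS : mutually_independent_mx P S.

(** The pi-system extension is used twice: over [J1] with [A0] fixed, then over [J0] with a cylinder
    of [J1] fixed. Two cylinders remain, and mutual independence settles them. *)
Lemma indep_sigma_of J0 J1 (A0 A1 : set T) : uniq (J0 ++ J1) ->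
  (measurable : set (set (sigma_of J0))) A0 ->
  (measurable : set (set (sigma_of J1))) A1 ->
  P (A0 `&` A1) = (P A0 * P A1)%E.
Proof.
move=> uJ mA0 mA1.
have := uJ; rewrite cat_uniq => /and3P[uJ0 /hasPn J01 uJ1].
apply: (@indep_sigma_algebra _ _ _ P (mx_cylinders J1)) => //.
- exact: mx_cylinders_setI.
- exact: measurable_mx_cylinders.
- exact: sub_sigma_of mA0.
move=> A cA; rewrite setIC muleC.
apply: (@indep_sigma_algebra _ _ _ P (mx_cylinders J0)) => //.
- exact: mx_cylinders_setI.
- exact: measurable_mx_cylinders.
- exact: measurable_mx_cylinders cA.
move=> A' [B0 /= mB0 <-]; case: cA => B1 /= mB1 <-; rewrite setIC muleC.
(* The lists are disjoint, so both cylinders come from one family of rectangles. *)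
pose B j := if j \in J0 then B0 j else B1 j.
have BJ0 : {in J0, B =1 B0} by move=> j jJ; rewrite /B jJ.
have BJ1 : {in J1, B =1 B1} by move=> j /J01; rewrite /B => /negbTE ->.
have cyl J B' : {in J, B =1 B'} -> mx_cylinder J B' = mx_cylinder J B.
  by move=> BB'; apply: eq_big_seq => j jJ; rewrite BB'.
have mB j a b : measurable (B j a b) by rewrite /B; case: ifP.
rewrite (cyl J0)// (cyl J1)// /mx_cylinder -big_cat/= !indS//.
by rewrite big_cat.
Qed.

(** Two disjoint groups of matrices may be integrated as if each had its own sample point. *)
Lemma sigma_of_decoupling J0 J1 (phi : sigma_of J0 * sigma_of J1 -> \bar R) :
  uniq (J0 ++ J1) -> measurable_fun setT phi -> (forall z, 0 <= phi z)%E ->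
  (\int[P]_w phi (w, w) = \int[P]_w \int[P]_w' phi (w, w'))%E.
Proof.
move=> uJ; apply: (ge0_decoupling P (to_sigma_of J0) (to_sigma_of J1)).
by move=> A B mA mB; exact: (indep_sigma_of J0 J1).
Qed.

Lemma has_mean_entryM i j a b a' b' m m' : i != j ->
  has_mean P (fun w => S i w a b) m -> has_mean P (fun w => S j w a' b') m' ->
  has_mean P (fun w => S i w a b * S j w a' b') (m * m').
Proof.
move=> ij mi mj.
apply: (has_mean_indepM P (to_sigma_of [:: i]) (to_sigma_of [:: j]) _
  (fun w => S i w a b) (fun w => S j w a' b')) => //.
- move=> A B mA mB; apply: (indep_sigma_of [:: i] [:: j]) => //=.
  by rewrite inE ij.
- by apply: measurable_mx_entry; rewrite inE.
- by apply: measurable_mx_entry; rewrite inE.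
Qed.

End random_matrices.

(** * Measurability of matrix expressions *)

Section measurable_matrices.
Context {dT : measure_display} {T : measurableType dT} {R : realType} {d : nat}.
Implicit Types M N : T -> 'M[R]_d.

Lemma mx_measurable_cst (A : 'M[R]_d) : mx_measurable (fun _ : T => A).
Proof. by move=> a b; exact: measurable_cst. Qed.

Lemma mx_measurableB M N : mx_measurable M -> mx_measurable N ->
  mx_measurable (fun w => M w - N w).
Proof.
move=> mM mN a b; under eq_fun do rewrite !mxE.
by apply: measurable_funB; [exact: mM|exact: mN].
Qed.

Lemma mx_measurableM M N : mx_measurable M -> mx_measurable N ->
  mx_measurable (fun w => M w *m N w).
Proof.
move=> mM mN a b; under eq_fun do rewrite !mxE.
apply: measurable_sum => j.
by apply: measurable_funM; [exact: mM|exact: mN].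
Qed.

End measurable_matrices.

(** * Equality of laws and transfer of means *)

Section equality_of_laws.
Context {dT : measure_display} {T : measurableType dT} {R : realType} {d : nat}.
Variable P : probability T R.

Definition mx_rectangles : set (set 'M[R]_d) :=
  [set [set A : 'M[R]_d | forall a b, B a b (A a b)] |
    B in [set B : 'I_d -> 'I_d -> set R | forall a b, measurable (B a b)]].

(** Generated by the rectangles on which [same_distribution_mx] compares laws. *)
Definition borel_mx := g_sigma_algebraType mx_rectangles.
HB.instance Definition _ := Measurable.copy borel_mx
  (g_sigma_algebraType mx_rectangles).

Lemma mx_measurable_borel : mx_measurable (fun A : borel_mx => A : 'M[R]_d).
Proof.
move=> a b _ B mB; rewrite setTI; apply: sub_gen_smallest.
exists (fun a' b' => if (a' == a) && (b' == b) then B else setT).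
  by move=> a' b' /=; case: ifPn.
apply/seteqP; split => A /=; first by move=> /(_ a b); rewrite !eqxx.
by move=> BA a' b'; case: ifPn => // /andP[/eqP -> /eqP ->].
Qed.

Lemma measurable_to_borel_mx (M : T -> 'M[R]_d) : mx_measurable M ->
  measurable_fun setT (M : T -> borel_mx).
Proof.
move=> mM; apply: (@measurability _ _ T borel_mx setT M mx_rectangles erefl) => _ [_ [B /= mB <-] <-].
rewrite setTI; exact: (measurable_mx_event M B).
Qed.

(** Rectangles form a pi-system, so the two laws coincide as measures, and each mean is an integral
    against the law. *)
Lemma same_distribution_has_mean (M N : T -> 'M[R]_d) (phi : borel_mx -> R) m :
  mx_measurable M -> mx_measurable N -> same_distribution_mx P M N ->
  measurable_fun setT phi ->
  has_mean P (phi \o M) m -> P.-integrable setT (EFin \o (phi \o N)) ->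
  has_mean P (phi \o N) m.
Proof.
move=> mM mN MN mphi [iM EM] iN; split => //.
pose X : {mfun T >-> borel_mx} := HB.pack (M : T -> borel_mx)
  (isMeasurableFun.Build _ _ _ _ _ (measurable_to_borel_mx _ mM)).
pose Y : {mfun T >-> borel_mx} := HB.pack (N : T -> borel_mx)
  (isMeasurableFun.Build _ _ _ _ _ (measurable_to_borel_mx _ mN)).
have mephi : measurable_fun setT (EFin \o phi) by exact/measurable_EFinP.
rewrite -EM.
transitivity (\int[distribution P Y]_A (phi A)%:E)%E.
  by rewrite integral_distribution.
transitivity (\int[distribution P X]_A (phi A)%:E)%E; last first.
  by rewrite integral_distribution.
apply: eq_measure_integral => A mA _.
apply: (@measure_unique _ R borel_mx mx_rectangles (fun=> setT) erefl _ _ _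
  (distribution P Y) (distribution P X)) => //.
- move=> _ _ [B /= mB <-] [B' /= mB' <-].
  exists (fun a b => B a b `&` B' a b).
    by move=> a b; exact: measurableI.
  apply/seteqP; split => [C h|C [h h'] a b]; last by split; [exact: h|exact: h'].
  by split => a b; have [] := h a b.
- by move=> _; exists (fun _ _ => setT) => //; apply/seteqP; split.
- by rewrite bigcup_const.
- by move=> _ [B /= mB <-]; apply/esym/MN.
- by move=> _; rewrite (le_lt_trans (probability_le1 _ _))// ltry.
Qed.

End equality_of_laws.

(** * Measurability of the iterates *)

Section measurable_vectors.
Context {R : realType} {d : nat} {dT : measure_display} {T : measurableType dT}.

Definition vec_measurable (X : T -> 'cV[R]_d) :=
  forall j, measurable_fun setT (fun w => X w j 0).

Lemma vec_measurable_mulmx (M : T -> 'M[R]_d) X :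
  mx_measurable M -> vec_measurable X -> vec_measurable (fun w => M w *m X w).
Proof.
move=> mM mX j; under eq_fun do rewrite mxE.
apply: measurable_sum => k.
by apply: measurable_funM; [exact: mM|exact: mX].
Qed.

Lemma vec_measurable_sum (I : Type) (r : seq I) (X : I -> T -> 'cV[R]_d) :
  (forall i, vec_measurable (X i)) -> vec_measurable (fun w => \sum_(i <- r) X i w).
Proof.
move=> mX j; under eq_fun do rewrite summxE.
by apply: measurable_sum => i; exact: mX.
Qed.

Lemma vec_measurableBZ a X Y : vec_measurable X -> vec_measurable Y ->
  vec_measurable (fun w => X w - a *: Y w).
Proof.
move=> mX mY j; under eq_fun do rewrite !mxE.
apply: measurable_funB; first exact: mX.
by apply: measurable_funM => //; exact: mY.
Qed.

Lemma measurable_qnorm2 Q X : vec_measurable X ->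
  measurable_fun setT (fun w => qnorm2 Q (X w)).
Proof.
move=> mX; under eq_fun do rewrite qnorm2_sum_entries.
apply: measurable_sum => i; apply: measurable_sum => j.
by apply: measurable_funM => //; apply: measurable_funM; exact: mX.
Qed.

(** One round of [iterate] with point and sketches as separate arguments, so that the sketches can
    be averaged at a frozen point. *)
Definition sketch_step {n} (fs : 'I_n -> 'cV[R]_d -> R) (D : 'M[R]_d) (x : 'cV[R]_d)
    (A : 'I_n -> 'M[R]_d) :=
  x - (n%:R^-1 : R) *: (D *m \sum_(i < n) (A i *m grad (fs i) x)).

Lemma vec_measurable_sketch_step n (fs : 'I_n -> 'cV[R]_d -> R) D X
    (A : 'I_n -> T -> 'M[R]_d) :
  (forall i x, differentiable (fs i) x) ->
  vec_measurable X -> (forall i, mx_measurable (A i)) ->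
  vec_measurable (fun w => sketch_step fs D (X w) (A ^~ w)).
Proof.
move=> dfs mX mA; apply: vec_measurableBZ => //.
apply: vec_measurable_mulmx; first exact: mx_measurable_cst.
apply: vec_measurable_sum => i; apply: vec_measurable_mulmx => // j.
exact: measurable_grad_comp.
Qed.

(** Measurability is asked of the rounds before [k] only, so [T] may carry the sigma-algebra of the
    past. *)
Lemma vec_measurable_iterate n (fs : 'I_n -> 'cV[R]_d -> R) D
    (S : 'I_n -> nat -> T -> 'M[R]_d) x0 k :
  (forall i x, differentiable (fs i) x) ->
  (forall i j, (j < k)%N -> mx_measurable (S i j)) ->
  vec_measurable (iterate fs D S x0 k).
Proof.
move=> dfs; elim: k => [|k IH] mS; first by move=> j; exact: measurable_cst.
apply: (vec_measurable_sketch_step n fs D (iterate fs D S x0 k)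
  (fun i => S i k)) => //.
- by apply: IH => i j jk; apply: mS; rewrite ltnW.
- by move=> i; exact: mS.
Qed.

End measurable_vectors.

(** * Differentiability and gradient of the average *)

Section gradient_of_mean.
Context {R : realType} {d n : nat}.
Variable fs : 'I_n -> 'cV[R]_d -> R.
Hypothesis dfs : forall i x, differentiable (fs i) x.

Lemma differentiable_mean x :
  differentiable (fun x => n%:R^-1 * \sum_(i < n) fs i x) x.
Proof.
have -> : (fun x => n%:R^-1 * \sum_(i < n) fs i x) = n%:R^-1 *: (\sum_(i < n) fs i).
  by apply/funext => y; rewrite /= fct_sumE.
by apply: differentiableZ; apply: differentiable_sum => i.
Qed.

Lemma grad_mean x : grad (fun x => n%:R^-1 * \sum_(i < n) fs i x) x =
  n%:R^-1 *: \sum_(i < n) grad (fs i) x.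
Proof.
apply/matrixP => j k; rewrite !mxE summxE.
have -> : (fun x => n%:R^-1 * \sum_(i < n) fs i x) = n%:R^-1 *: (\sum_(i < n) fs i).
  by apply/funext => y; rewrite /= fct_sumE.
have der i : derivable (fs i) x (delta_mx j 0) by exact: diff_derivable.
rewrite deriveZ; last exact: derivable_sum.
by rewrite derive_sum//; congr (_ * _); apply: eq_bigr => i _; rewrite mxE.
Qed.

End gradient_of_mean.

(** * Second moments of sums of uncorrelated vectors *)

Section noise.
Context {dT : measure_display} {T : measurableType dT} {R : realType} {d n : nat}.
Variable P : probability T R.

(** Sketches are symmetric only almost surely, so identities based on symmetry pass through this
    lemma. *)
Lemma has_mean_ae (X Y : T -> R) m : measurable_fun setT Y ->
  {ae P, forall w, X w = Y w} -> has_mean P X m -> has_mean P Y m.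
Proof.
move=> mY XY [/integrableP[mX iX] EX].
have mEY : measurable_fun setT (EFin \o Y) by exact/measurable_EFinP.
have aeXY : ae_eq P setT (EFin \o Y) (EFin \o X).
  by apply: filterS XY => w /= -> _.
split; last by rewrite -EX; exact: ae_eq_integral.
apply/integrableP; split => //; apply: le_lt_trans iX.
rewrite le_eqVlt; apply/orP; left; apply/eqP; apply: ae_eq_integral => //.
- exact: measurableT_comp.
- exact: measurableT_comp.
- by apply: filterS XY => w /= -> _.
Qed.

Lemma has_mean_dotv (u : 'cV[R]_d) (X : T -> 'cV[R]_d) (m : 'cV[R]_d) :
  (forall a, has_mean P (fun w => X w a 0) (m a 0)) ->
  has_mean P (fun w => dotv u (X w)) (dotv u m).
Proof.
move=> Xm; rewrite dotvE.
apply: has_mean_ext (has_mean_sum P _ _ _ _ (fun a => has_meanZ P (u a 0) _ _ (Xm a))).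
by move=> w; rewrite dotvE.
Qed.

(** Expanding the form over pairs, the off-diagonal terms have mean 0. *)
Lemma has_mean_qnorm2_sum (Q : 'M[R]_d) (v : 'I_n -> T -> 'cV[R]_d) (q : 'I_n -> R) :
  (forall i j a b, i != j -> has_mean P (fun w => v i w a 0 * v j w b 0) 0) ->
  (forall i, has_mean P (fun w => qnorm2 Q (v i w)) (q i)) ->
  has_mean P (fun w => qnorm2 Q (\sum_(i < n) v i w)) (\sum_(i < n) q i).
Proof.
move=> cross diag.
have entry i j : has_mean P (fun w => dotv (Q *m v i w) (v j w))
    (if i == j then q i else 0).
  have [<-|ij] := eqVneq i j; first exact: diag.
  have sum0 : 0 = \sum_(a < d) \sum_(b < d) Q a b * 0 :> R.
    by rewrite big1// => a _; rewrite big1// => b _; rewrite mulr0.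
  rewrite sum0.
  apply: has_mean_ext (has_mean_sum P _ _ _ _ (fun a =>
    has_mean_sum P _ _ _ _ (fun b => has_meanZ P (Q a b) _ _ (cross i j b a ij)))).
  move=> w; rewrite dotvE; apply: eq_bigr => a _.
  by rewrite mxE mulr_suml; apply: eq_bigr => b _; rewrite mulrA.
have -> : \sum_(i < n) q i = \sum_(i < n) \sum_(j < n) (if i == j then q i else 0).
  apply: eq_bigr => i _; rewrite (bigD1 i)//= eqxx big1 ?addr0// => j.
  by rewrite eq_sym => /negbTE ->.
apply: has_mean_ext (has_mean_sum P _ _ _ _ (fun i =>
  has_mean_sum P _ _ _ _ (fun j => entry i j))).
move=> w; rewrite /qnorm2 mulmx_sumr dotv_suml.
by apply: eq_bigr => i _; rewrite dotv_sumr.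
Qed.

End noise.

(** * Expected descent from a frozen point *)

Section expected_descent.
Context {dT : measure_display} {T : measurableType dT} {R : realType} {d n : nat}.
Variable P : probability T R.
Variables (fs : 'I_n -> 'cV[R]_d -> R) (finf_i : 'I_n -> R).
Variables (Ls Lh : 'I_n -> 'M[R]_d) (finf lam : R) (L D : 'M[R]_d).
Variable S : 'I_n -> T -> 'M[R]_d.
Let f x := n%:R^-1 * \sum_(i < n) fs i x.
Let M i w :=
  Lh i *m (S i w - 1%:M) *m D *m L *m D *m (S i w - 1%:M) *m Lh i.
Hypotheses (n0 : (0 < n)%N) (dfs : forall i x, differentiable (fs i) x).
Hypotheses (fs_ge : forall i x, finf_i i <= fs i x) (f_ge : forall x, finf <= f x).
Hypotheses (pdLs : forall i, pd (Ls i)).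
Hypotheses (sfs : forall i, matrix_smooth (fs i) (Ls i)).
Hypotheses (LhLs : forall i, psd (Lh i) /\ Lh i *m Lh i = Ls i).
Hypotheses (psdL : psd L) (sf : matrix_smooth f L).
Hypotheses (Ds : D^T = D) (DLD : loewner_le (D *m L *m D) D).
Hypotheses (mS : forall i, mx_measurable (S i)).
Hypotheses (psdS : forall i, {ae P, forall w, psd (S i w)}).
Hypotheses (ES : forall i a b, has_mean P (fun w => S i w a b) (a == b)%:R).
Hypotheses (ESS : forall i j a b a' b', i != j ->
  has_mean P (fun w => S i w a b * S j w a' b') ((a == b)%:R * (a' == b')%:R)).
Hypotheses (iM : forall i, mx_integrable P (M i)).
Hypotheses (lam0 : 0 <= lam)
  (lam_ge : forall i, lambda_max (mexp P (M i)) <= lam).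

Let noise i (g : 'cV[R]_d) w := (S i w - 1%:M) *m g.

Let noiseE i g w a : noise i g w a 0 = \sum_b g b 0 * (S i w a b - (a == b)%:R).
Proof. by rewrite mxE; apply: eq_bigr => b _; rewrite !mxE mulrC. Qed.

Let noise_mean i g a : has_mean P (fun w => noise i g w a 0) 0.
Proof.
have -> : 0 = \sum_b g b 0 * ((a == b)%:R + - (a == b)%:R) :> R.
  by rewrite big1// => b _; rewrite subrr mulr0.
apply: has_mean_ext (has_mean_sum P _ _ _ _ (fun b => has_meanZ P (g b 0) _ _
  (has_meanD P _ _ _ _ (ES i a b) (has_mean_cst P (- (a == b)%:R))))).
by move=> w; rewrite noiseE.
Qed.

Let noise_cross i j g g' a a' : i != j ->
  has_mean P (fun w => noise i g w a 0 * noise j g' w a' 0) 0.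
Proof.
move=> ij.
have centred b b' : has_mean P
    (fun w => (S i w a b - (a == b)%:R) * (S j w a' b' - (a' == b')%:R)) 0.
  set c : R := (a == b)%:R; set c' : R := (a' == b')%:R.
  (* The means of the four terms of the product of centred entries. *)
  have -> : 0 = c * c' + (- c' * c + (- c * c' + c * c')) by ring.
  apply: has_mean_ext (has_meanD P _ _ _ _ (ESS i j a b a' b' ij)
    (has_meanD P _ _ _ _ (has_meanZ P (- c') _ _ (ES i a b))
    (has_meanD P _ _ _ _ (has_meanZ P (- c) _ _ (ES j a' b'))
      (has_mean_cst P (c * c'))))).
  by move=> w; rewrite /c /c'; ring.
have -> : 0 = \sum_b \sum_b' g b 0 * g' b' 0 * 0 :> R.
  by rewrite big1// => b _; rewrite big1// => b' _; rewrite mulr0.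
apply: has_mean_ext (has_mean_sum P _ _ _ _ (fun b => has_mean_sum P _ _ _ _
  (fun b' => has_meanZ P (g b 0 * g' b' 0) _ _ (centred b b')))).
move=> w; rewrite !noiseE mulr_suml; apply: eq_bigr => b _.
by rewrite mulr_sumr; apply: eq_bigr => b' _; ring.
Qed.

Let Q := D *m L *m D.

Let Qs : Q^T = Q.
Proof. by rewrite /Q !trmx_mul Ds (proj1 psdL) mulmxA. Qed.

Let M_mean i a b : has_mean P (fun w => M i w a b) (mexp P (M i) a b).
Proof. by rewrite mxE; apply: has_mean_integrable; exact: iM. Qed.

(** [M i] is symmetric wherever [S i] is; the Rayleigh bound relies on this symmetry. *)
Let mexpM_sym i : (mexp P (M i))^T = mexp P (M i).
Proof.
apply/matrixP => a b; rewrite mxE.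
apply: (@has_mean_unique _ _ _ P (fun w => M i w a b)); last exact: M_mean.
apply: has_mean_ae (M_mean i b a).
  have [/integrableP[/measurable_EFinP]] := M_mean i a b; exact.
apply: filterS (psdS i) => w [Sws _].
suff /(congr1 (fun A : 'M[R]_d => A b a)) : (M i w)^T = M i w by rewrite mxE => ->.
have Ns : (S i w - 1%:M)^T = S i w - 1%:M by rewrite linearB/= Sws trmx1.
rewrite /M !trmx_mul Ns Ds (proj1 psdL) (proj1 (proj1 (LhLs i))).
by rewrite !mulmxA.
Qed.

(** Where [S i] is symmetric, the outer factors of [M i] move across the inner product and leave the
    [Q]-form of the noise. *)
Let noise_diag i u : has_mean P (fun w => qnorm2 Q (noise i (Lh i *m u) w))
  (qnorm2 (mexp P (M i)) u).
Proof.
apply: (@has_mean_ae _ _ _ P (fun w => qnorm2 (M i w) u)).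
- apply: measurable_qnorm2 => a.
  by have [/integrableP[/measurable_EFinP]] := noise_mean i (Lh i *m u) a.
- apply: filterS (psdS i) => w [Sws _].
  rewrite /qnorm2 /noise /M /Q -!mulmxA dotv_mulmxl (proj1 (proj1 (LhLs i))).
  by rewrite dotv_mulmxl linearB/= Sws trmx1.
rewrite qnorm2_sum_entries.
under eq_bigr do under eq_bigr do rewrite mulrC.
apply: has_mean_ext (has_mean_sum P _ _ _ _ (fun a => has_mean_sum P _ _ _ _
  (fun b => has_meanZ P (u b 0 * u a 0) _ _ (M_mean i a b)))).
  move=> w; rewrite qnorm2_sum_entries; apply: eq_bigr => a _.
  by apply: eq_bigr => b _; rewrite mulrC.
Qed.

Lemma expected_descent x :
  (\int[P]_w (f (sketch_step fs D x (S ^~ w)) - finf)%:E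
     + (2^-1 * qnorm2 D (grad f x))%:E
   <= ((1 + lam / n%:R) * (f x - finf)
     + lam * (finf - n%:R^-1 * \sum_(i < n) finf_i i) / n%:R)%:E)%E.
Proof.
have n0' : n%:R != 0 :> R by rewrite pnatr_eq0 -lt0n.
have ninv0 : 0 <= n%:R^-1 :> R by rewrite invr_ge0.
have /choice[u uP] : forall i, exists u, grad (fs i) x = Lh i *m u /\
    dotv u u <= 2 * (fs i x - finf_i i).
  move=> i; have [psdLh LhE] := LhLs i.
  by have [u ? ?] := matrix_smooth_grad_bound _ _ _ _ x (sfs i) (fs_ge i)
    (pdLs i) psdLh LhE; exists u.
set g := grad f x.
have gE : g = n%:R^-1 *: \sum_(i < n) grad (fs i) x by exact: grad_mean.
pose v i w := noise i (grad (fs i) x) w.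
pose V w := \sum_(i < n) v i w.
pose q i := qnorm2 (mexp P (M i)) (u i).
have VQ : has_mean P (fun w => qnorm2 Q (V w)) (\sum_(i < n) q i).
  apply: has_mean_qnorm2_sum => [i j a b ij|i]; first exact: noise_cross.
  by rewrite /v (proj1 (uP i)); exact: noise_diag.
have Vlin y : has_mean P (fun w => dotv y (V w)) 0.
  have -> : 0 = dotv y (0 : 'cV[R]_d) by rewrite dotvC dotv0l.
  apply: has_mean_dotv => a; rewrite mxE.
  have -> : 0 = \sum_(i < n) 0 :> R by rewrite big1.
  apply: has_mean_ext (has_mean_sum P _ _ _ _
    (fun i => noise_mean i (grad (fs i) x) a)).
  by move=> w; rewrite /V summxE.
(* Splitting each sketch into identity plus noise isolates the exact gradient step. *)
have stepE w : sketch_step fs D x (S ^~ w) = x - D *m (g + n%:R^-1 *: V w).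
  rewrite /sketch_step gE -scalerDr -scalemxAr -big_split/=; congr (_ - _ *: (_ *m _)).
  apply: eq_bigr => i _; rewrite /v /noise mulmxBl mul1mx.
  by rewrite addrC subrK.
pose c0 := f x - finf - qnorm2 D g + 2^-1 * qnorm2 Q g.
(* The smoothness upper bound at the next iterate, sorted by degree in the noise; its linear part
   has mean 0. *)
pose Z w := c0 + (n%:R^-1 * dotv (Q *m g - D *m g) (V w)
  + 2^-1 * n%:R^-1 ^+ 2 * qnorm2 Q (V w)).
have ZE : has_mean P Z (c0 + (n%:R^-1 * 0 + 2^-1 * n%:R^-1 ^+ 2 * \sum_(i < n) q i)).
  exact: has_meanD (has_mean_cst P _) (has_meanD P _ _ _ _ (has_meanZ P _ _ _ (Vlin _))
    (has_meanZ P _ _ _ VQ)).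
have leZ w : f (sketch_step fs D x (S ^~ w)) - finf <= Z w.
  have := sf (sketch_step fs D x (S ^~ w)) x; rewrite stepE.
  set h := g + _; have -> : x - D *m h - x = - (D *m h) by rewrite addrAC subrr add0r.
  have -> : qnorm2 L (- (D *m h)) = qnorm2 Q h.
    by rewrite -scaleN1r qnorm2Z sqrrN expr1n mul1r /qnorm2 /Q -!mulmxA
      (dotv_mulmxl D) Ds.
  have -> : dotv (grad f x) (- (D *m h)) =
      - (qnorm2 D g + n%:R^-1 * dotv (D *m g) (V w)).
    by rewrite dotvNr dotvC dotv_mulmxl Ds dotvC /h dotvDr dotvZr.
  rewrite /Z /c0 /h qnorm2D// qnorm2Z dotvZr dotvDl dotvNl; lra.
have mF : measurable_fun setT (fun w => f (sketch_step fs D x (S ^~ w)) - finf).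
  apply: measurable_funB => //; apply: measurable_continuous_comp_vec.
    by move=> y; apply: differentiable_continuous; exact: differentiable_mean.
  by apply: (vec_measurable_sketch_step n fs D (fun=> x) S).
have F0 w : 0 <= f (sketch_step fs D x (S ^~ w)) - finf by rewrite subr_ge0.
have intF : (\int[P]_w (f (sketch_step fs D x (S ^~ w)) - finf)%:E <=
    (c0 + 2^-1 * n%:R^-1 ^+ 2 * \sum_(i < n) q i)%:E)%E.
  have [/integrableP[mZ _] EZ] := ZE; rewrite mulr0 add0r in EZ; rewrite -EZ.
  apply: ge0_le_integral => //.
  - by move=> w _; rewrite lee_fin.
  - exact/measurable_EFinP.
  - by move=> w _; rewrite lee_fin.
(* This leaves at least half of the decrease [qnorm2 D g] in [c0]. *)
have Qg : qnorm2 Q g <= qnorm2 D g.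
  have := proj2 DLD g; rewrite {1}/qnorm2 mulmxBl dotvDl dotvNl subr_ge0.
  exact.
have qle i : q i <= 2 * lam * (fs i x - finf_i i).
  apply: (le_trans (rayleigh_le_lambda_max _ _ (mexpM_sym i))).
  apply: (le_trans (ler_wpM2r (dotvv_ge0 _) (lam_ge i))).
  by rewrite -mulrA mulrCA ler_wpM2l// (proj2 (uP i)).
have sumq : \sum_(i < n) q i <=
    2 * lam * (n%:R * f x - \sum_(i < n) finf_i i).
  rewrite /f mulVKf// -sumrB mulr_sumr; exact: ler_sum.
apply: (le_trans (leeD2r _ intF)); rewrite -EFinD lee_fin.
have := ler_wpM2l (exprn_ge0 2 ninv0) sumq.
rewrite /c0 -/g; set s := \sum_(i < n) q i; set t := \sum_(i < n) _.
move=> h.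
(* The average of the gaps of the [fs i] is the gap of [f] plus Delta^inf. *)
have -> : (1 + lam / n%:R) * (f x - finf) + lam * (finf - n%:R^-1 * t) / n%:R
  = f x - finf + 2^-1 * (n%:R^-1 ^+ 2 * (2 * lam * (n%:R * f x - t))).
  by field.
lra.
Qed.

End expected_descent.

(** * Indices of the sketches of past and current rounds *)

Section index_lists.
Variable n : nat.

Definition past (k : nat) : seq ('I_n * nat) :=
  [seq (i, j) | i <- enum 'I_n, j <- iota 0 k].
Definition present (k : nat) : seq ('I_n * nat) := [seq (i, k) | i <- enum 'I_n].

Lemma mem_past k i j : ((i, j) \in past k) = (j < k)%N.
Proof.
apply/allpairsP/idP => [[[i' j'] /= []] |jk].
  by rewrite mem_iota => _ + [_ ->].
by exists (i, j); rewrite mem_enum mem_iota.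
Qed.

Lemma mem_present k i : (i, k) \in present k.
Proof. by apply/mapP; exists i; rewrite ?mem_enum. Qed.

Lemma uniq_past_present k : uniq (past k ++ present k).
Proof.
rewrite cat_uniq; apply/and3P; split.
- by apply: allpairs_uniq => [||[? ?] [? ?] _ _ [-> ->]//];
    [exact: enum_uniq|exact: iota_uniq].
- by apply/hasPn => _ /mapP[i _ ->]; rewrite mem_past ltnn.
- by rewrite map_inj_uniq ?enum_uniq// => ? ? [].
Qed.

End index_lists.

(** * From frozen points to random iterates *)

Theorem theorem3 (R : realType) (d n : nat) (dT : measure_display)
  (T : measurableType dT) (P : probability T R)
  (fs : 'I_n -> 'cV[R]_d -> R) (finf_i : 'I_n -> R)
  (Ls Lh : 'I_n -> 'M[R]_d) (finf : R) (L D : 'M[R]_d)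
  (S : 'I_n -> nat -> T -> 'M[R]_d) (x0 : 'cV[R]_d) (K : nat) :
  (0 < n)%N ->
  (forall i x, differentiable (fs i) x) ->
  (forall i x, finf_i i <= fs i x) ->
  (forall i, pd (Ls i)) ->
  (forall i, matrix_smooth (fs i) (Ls i)) ->
  (* Lh i is the (unique) symmetric PSD square root L_i^{1/2} of L_i *)
  (forall i, psd (Lh i) /\ Lh i *m Lh i = Ls i) ->
  let f := fun x => n%:R^-1 * \sum_(i < n) fs i x in
  (forall x, finf <= f x) ->
  psd L ->
  matrix_smooth f L ->
  (forall i k, mx_measurable (S i k)) ->
  mutually_independent_mx P (fun ik : 'I_n * nat => S ik.1 ik.2) ->
  (forall i k i' k', same_distribution_mx P (S i k) (S i' k')) ->
  (forall i k, {ae P, forall w, psd (S i k w)}) ->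
  (forall i k, mx_integrable P (S i k)) ->
  (forall i k, mexp P (S i k) = 1%:M) ->
  let M := fun i k w =>
    Lh i *m (S i k w - 1%:M) *m D *m L *m D *m (S i k w - 1%:M) *m Lh i in
  (forall i k, mx_integrable P (M i k)) ->
  pd D ->
  loewner_le (D *m L *m D) D ->
  (1 <= K)%N ->
  let c := powR (\det D) (d%:R^-1) in
  let lamD := \big[Num.max/0]_(i < n) lambda_max (mexp P (M i 0%N)) in
  let Delta := finf - n%:R^-1 * \sum_(i < n) finf_i i in
  (\big[Order.min/+oo]_(k < K)
      'E_P[fun w => qnorm2 (c^-1 *: D) (grad f (iterate fs D S x0 k w))]
   <= (2 * (1 + lamD / n%:R) ^+ K * (f x0 - finf) / (c * K%:R)
       + 2 * lamD * Delta / (c * n%:R))%:E)%E.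
Proof.
move=> n0 dfs fs_ge pdLs sfs LhLs f f_ge psdL sf mS indS sameS psdS iS ES M iM
  pdD DLD K0.
pose c := powR (\det D) (d%:R^-1).
pose lamD := \big[Num.max/0]_(i < n) lambda_max (mexp P (M i 0%N)).
pose Delta := finf - n%:R^-1 * \sum_(i < n) finf_i i.
cbv zeta; rewrite -/c -/lamD -/Delta.
have c0 : 0 < c by apply: powR_det_gt0; exact: pd_unitmx.
have n0' : 0 < n%:R :> R by rewrite ltr0n.
have lam0 : 0 <= lamD by apply: bigmax_ge_id.
have df x : differentiable f x by exact: differentiable_mean.
have fc : continuous f by move=> x; exact: differentiable_continuous.
(* [lamD] is defined from round 0; equality of laws carries it to every round. *)
have mexpM i k : mexp P (M i k) = mexp P (M i 0%N).
  apply/matrixP => a b; rewrite [LHS]mxE.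
  apply: (@has_mean_unique _ _ _ P (fun w => M i k w a b)).
    exact: (has_mean_integrable P _ (iM i k a b)).
  pose phi (A : borel_mx) : R :=
    (Lh i *m (A - 1%:M) *m D *m L *m D *m (A - 1%:M) *m Lh i) a b.
  apply: (@same_distribution_has_mean _ _ _ _ P (S i 0%N) (S i k) phi) => //.
  - apply: (_ : mx_measurable (fun A : borel_mx =>
      Lh i *m (A - 1%:M) *m D *m L *m D *m (A - 1%:M) *m Lh i)).
    have mB : mx_measurable (fun A : @borel_mx R d => (A : 'M[R]_d) - 1%:M).
      by apply: mx_measurableB; [exact: mx_measurable_borel|exact: mx_measurable_cst].
    by do 6 (apply: mx_measurableM => //; try exact: mx_measurable_cst).
  - by rewrite mxE; apply: has_mean_integrable; exact: iM.
  - exact: iM.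
have lam_ge i k : lambda_max (mexp P (M i k)) <= lamD.
  by rewrite mexpM; exact: (le_bigmax _ (fun i => lambda_max (mexp P (M i 0%N)))).
have ESe i k a b : has_mean P (fun w => S i k w a b) (a == b)%:R.
  have := congr1 (fun A : 'M[R]_d => A a b) (ES i k); rewrite !mxE => <-.
  exact: (has_mean_integrable P _ (iS i k a b)).
have step k x : (\int[P]_w (f (sketch_step fs D x (fun i => S i k w)) - finf)%:E
    + (2^-1 * qnorm2 D (grad f x))%:E
    <= ((1 + lamD / n%:R) * (f x - finf) + lamD * Delta / n%:R)%:E)%E.
  apply: (@expected_descent _ _ _ _ _ P fs finf_i Ls Lh finf lamD L D
    (fun i => S i k)) => //.
  - by case: pdD.
  - move=> i j a b a' b' ij.
    apply: (@has_mean_entryM _ _ _ _ P _ (fun ik : 'I_n * nat => S ik.1 ik.2)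
      _ indS (i, k) (j, k)) => //.
    by apply: contraNN ij => /eqP[->].
  - by move=> i; exact: iM.
  - by move=> i; exact: lam_ge.
pose X k := iterate fs D S x0 k.
have mX k : vec_measurable (X k) by apply: vec_measurable_iterate.
(* These integrals stay in the extended reals until the recursion shows them finite. *)
pose delta k := (\int[P]_w (f (X k w) - finf)%:E)%E.
pose rho k := (\int[P]_w (qnorm2 D (grad f (X k w)))%:E)%E.
have qD0 y : 0 <= qnorm2 D y.
  have [-> |yn0] := eqVneq y 0; first by rewrite /qnorm2 mulmx0 dotv0l.
  by apply: ltW; exact: (proj2 pdD y yn0).
have fX0 k w : (0 <= (f (X k w) - finf)%:E)%E by rewrite lee_fin subr_ge0.
have mfX k : measurable_fun setT (fun w => (f (X k w) - finf)%:E).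
  apply/measurable_EFinP; apply: measurable_funB => //.
  exact: (measurable_continuous_comp_vec f (X k) fc (mX k)).
have mqX k : measurable_fun setT (fun w => qnorm2 D (grad f (X k w))).
  by apply: measurable_qnorm2 => j; exact: (measurable_grad_comp f (X k) j df (mX k)).
pose a := 1 + lamD / n%:R; pose b := lamD * Delta / n%:R.
have a1 : 1 <= a by rewrite lerDl divr_ge0// ltW.
have rec k : (delta k.+1 + 2^-1%:E * rho k <= a%:E * delta k + b%:E)%E.
  pose next (xw : 'cV[R]_d) w' := f (sketch_step fs D xw (fun i => S i k w')) - finf.
  (* Generic in the two spaces: it serves for past and present sigma-algebras and for two copies of
     [T]. *)
  have mnext d0 d1 (U0 : measurableType d0) (U1 : measurableType d1)
      (X' : U0 -> 'cV[R]_d) (S' : 'I_n -> U1 -> 'M[R]_d) :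
      vec_measurable X' -> (forall i, mx_measurable (S' i)) ->
      measurable_fun setT (fun p : U0 * U1 =>
        (f (sketch_step fs D (X' p.1) (fun i => S' i p.2)) - finf)%:E).
    move=> mX' mS'; apply/measurable_EFinP; apply: measurable_funB => //.
    apply: measurable_continuous_comp_vec => //.
    apply: (vec_measurable_sketch_step n fs D (fun p : U0 * U1 => X' p.1)
      (fun i p => S' i p.2)) => //.
    - by move=> j; apply: measurableT_comp (mX' j) _.
    - by move=> i a' b'; apply: measurableT_comp (mS' i a' b') _.
  have next0 x w' : (0 <= (next x w')%:E)%E by rewrite lee_fin subr_ge0.
  have dec : delta k.+1 = (\int[P]_w \int[P]_w' (next (X k w) w')%:E)%E.
    apply: (sigma_of_decoupling P (fun ik : 'I_n * nat => S ik.1 ik.2)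
      (fun ik => mS ik.1 ik.2) indS (past n k) (present n k)
      (fun p => (next (X k p.1) p.2)%:E)) => //.
    - exact: uniq_past_present.
    - apply: (mnext _ _ (sigma_of (fun ik : 'I_n * nat => S ik.1 ik.2) (past n k))
        (sigma_of (fun ik : 'I_n * nat => S ik.1 ik.2) (present n k)) (X k)
        (fun i w => S i k w)).
        apply: vec_measurable_iterate => // i j jk a' b'.
        by apply: (measurable_mx_entry _ _ (i, j)); rewrite mem_past.
      move=> i a' b'; apply: (measurable_mx_entry _ _ (i, k)).
      exact: mem_present.
  have mI : measurable_fun setT (fun w => \int[P]_w' (next (X k w) w')%:E)%E.
    apply: (@measurable_fun_fubini_tonelli_F _ _ T T R P
      (fun p : T * T => (next (X k p.1) p.2)%:E)) => //.
    by apply: (mnext _ _ T T (X k) (fun i => S i k)).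
  (* If [delta k] is infinite, so is the right side, since [a] is positive. *)
  have [fd|] := boolP (delta k \is a fin_num); last first.
    rewrite ge0_fin_numE ?integral_ge0// -leNgt leye_eq => /eqP ->.
    by rewrite gt0_muley ?lte_fin ?(lt_le_trans ltr01)// addye// leey.
  have fk : has_mean P (fun w => f (X k w) - finf) (fine (delta k)).
    split; last by rewrite fineK.
    apply/integrableP; split; first exact: mfX.
    under eq_integral => w _ do rewrite (gee0_abs (fX0 k w)).
    by rewrite -ge0_fin_numE ?integral_ge0.
  rewrite -[X in (_ <= _ * X + _)%E](fineK fd) -EFinM -EFinD.
  have [/integrableP[mh _] <-] := has_meanD P _ _ _ _ (has_meanZ P a _ _ fk)
    (has_mean_cst P b).
  have mhalf : measurable_fun setT (fun w => (2^-1 * qnorm2 D (grad f (X k w)))%:E).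
    by apply/measurable_EFinP; exact: measurable_funM.
  have half0 w : (0 <= (2^-1 * qnorm2 D (grad f (X k w)))%:E)%E.
    by rewrite lee_fin mulr_ge0.
  have -> : (2^-1%:E * rho k = \int[P]_w (2^-1 * qnorm2 D (grad f (X k w)))%:E)%E.
    under eq_integral do rewrite EFinM.
    rewrite ge0_integralZl//; first exact/measurable_EFinP.
    by move=> w _; rewrite lee_fin.
  have next_int0 w : (0 <= \int[P]_w' (next (X k w) w')%:E)%E.
    exact: integral_ge0.
  (* Both sides are now integrals over the past sample point, compared pointwise by [step]. *)
  rewrite dec -ge0_integralD//.
  apply: ge0_le_integral => //.
  - by move=> w _; exact: adde_ge0.
  - exact: emeasurable_funD.
  - by move=> w _; exact: step.
pose deltar k := fine (delta k); pose rhor k := fine (rho k).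
have delta0 : delta 0%N = (f x0 - finf)%:E.
  by have [] := has_mean_cst P (f x0 - finf).
have rho_ge0 k : (0 <= rho k)%E by apply: integral_ge0 => w _; rewrite lee_fin.
have delta_ge0 k : (0 <= delta k)%E by exact: integral_ge0.
have fin k : (delta k \is a fin_num) /\ (rho k \is a fin_num).
  have half (y : \bar R) : (0 <= y)%E -> (2^-1%:E * y < +oo)%E -> (y < +oo)%E.
    by case: y => [r _ _|_|//]; rewrite ?ltry// mulry gtr0_sg// mul1e.
  (* Both terms on the left of [rec j] are nonnegative, so a finite right side makes each finite. *)
  have fins j : delta j \is a fin_num ->
      (delta j.+1 \is a fin_num) /\ (rho j \is a fin_num).
    move=> fj; have ub : (a%:E * delta j + b%:E < +oo)%E.
      by rewrite ltey_eq fin_numD fin_numM.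
    have h0 : (0 <= 2^-1%:E * rho j)%E by rewrite mule_ge0// lee_fin.
    rewrite !ge0_fin_numE//; split.
      by apply: le_lt_trans ub; apply: le_trans (rec j); rewrite leeDl.
    apply: half => //.
    by apply: le_lt_trans ub; apply: le_trans (rec j); rewrite leeDr.
  have fd : delta k \is a fin_num.
    by elim: k => [|k IH]; [rewrite delta0|have [] := fins k IH].
  by split=> //; have [] := fins k fd.
have [k kK rk] : exists2 k, (k < K)%N &
    rhor k <= 2 * a ^+ K * deltar 0%N / K%:R + 2 * b.
  apply: descent_recursion => // k; first by rewrite fine_ge0.
  have := rec k; have [fd fr] := fin k; have [fd' _] := fin k.+1.
  by rewrite -(fineK fd) -(fineK fr) -(fineK fd') -!EFinM -!EFinD lee_fin.
apply/bigmin_leP; right; exists (Ordinal kK) => //=.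
rewrite unlock.
under eq_integral => w _.
  rewrite /qnorm2 -scalemxAl dotvZl -/(qnorm2 D _) EFinM; over.
rewrite /= ge0_integralZl//; last 3 first.
- exact/measurable_EFinP.
- by move=> w _; rewrite lee_fin.
- by rewrite lee_fin invr_ge0 ltW.
rewrite -/(rho k) -(fineK (proj2 (fin k))) -EFinM lee_fin -/(rhor k).
rewrite mulrC ler_pdivrMr//; apply: (le_trans rk).
rewrite /deltar delta0 /= /a /b le_eqVlt; apply/orP; left; apply/eqP; field.
by rewrite !gt_eqF// ltr0n.
Qed.
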